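(* Let $X$ be a compact metric space, $T:X\to X$ continuous, and $\mu$ a $T$-invariant ergodic Borel probability measure on $X$. Let $\alpha=\{A_1,\dots,A_r\}$ be a finite measurable partition of $X$ and let $Z$ be an optimal reversible coding algorithm on the alphabet $\{1,\dots,r\}$. Then for $\mu$-almost every $x\in X$, $$K_Z(x,\alpha)=h_\mu(T,\alpha),$$ where $h_\mu(T,\alpha)$ is the Kolmogorov–Sinai entropy of $T$ with respect to $\alpha$.
   Context: The symbolic coding $\varphi_\alpha:X\to\{1,\dots,r\}^{\mathbb{N}}$ is $\varphi_\alpha(x)=\omega$ where $T^j(x)\in A_{\omega_j}$ for all $j\in\mathbb{N}$. $K_Z(x,\alpha)=\limsup_{n\to\infty}|Z(\omega^n)|/n$ with $\omega=\varphi_\alpha(x)$ and $\omega^n$ its first $n$ symbols. Empirical entropy of a finite string $s$ of length $n$: $P(s,w)=\frac{1}{n-l+1}\#\{0\le i\le n-l:s_{i+1}\cdots s_{i+l}=w\}$ for $w$ of length $l$, $\hat H_l(s)=-\frac1l\sum_wP(s,w)\log_2P(s,w)$. A reversible coding algorithm is an injective recursive map $Z$ from finite strings to finite binary strings; it is optimal if for each $k$ there exists $f_k$ with $f_k(n)=o(n)$ such that $|Z(s)|/|s|\le\hat H_k(s)+f_k(|s|)/|s|$ for all finite strings $s$. *)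

(* Defs.v *)
From HB Require Import structures.
From mathcomp Require Import all_boot all_order all_algebra.
From mathcomp Require Import all_classical all_reals all_analysis.
Set Implicit Arguments. Unset Strict Implicit. Unset Printing Implicit Defensive.
Import Order.TTheory GRing.Theory Num.Theory.
Import numFieldNormedType.Exports.
Local Open Scope classical_set_scope.
Local Open Scope ring_scope.

Definition borel (X : ptopologicalType) : measurableType ((@open X).-sigma) :=
  g_sigma_algebraType (@open X).

Definition log2 {R : realType} (x : R) : R := ln x / ln 2.

Definition eta {R : realType} (p : R) : R := if p == 0 then 0 else - (p * log2 p).

Definition measurable_partition d (X : measurableType d) (r : nat)
  (A : 'I_r -> set X) : Prop :=
  (forall i, measurable (A i)) /\
  (forall i j, i != j -> A i `&` A j = set0) /\
  (\bigcup_(i in [set: 'I_r]) A i = [set: X]).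

Definition measure_invariant d (X : measurableType d) (R : realType)
  (mu : {measure set X -> \bar R}) (T : X -> X) : Prop :=
  forall B, measurable B -> mu (T @^-1` B) = mu B.

Definition measure_ergodic d (X : measurableType d) (R : realType)
  (mu : {measure set X -> \bar R}) (T : X -> X) : Prop :=
  forall B, measurable B -> T @^-1` B = B -> mu B = 0%E \/ mu B = 1%E.

Definition cylinder (X : Type) (r n : nat) (A : 'I_r -> set X) (T : X -> X)
  (w : n.-tuple 'I_r) : set X :=
  \bigcap_(i in [set k : 'I_n | True]) (iter i T @^-1` A (tnth w i)).

Definition join_entropy d (X : measurableType d) (R : realType)
  (mu : {measure set X -> \bar R}) (T : X -> X) (r : nat) (A : 'I_r -> set X)
  (n : nat) : R :=
  \sum_(w : n.-tuple 'I_r) eta (fine (mu (cylinder A T w))).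

Definition ks_entropy d (X : measurableType d) (R : realType)
  (mu : {measure set X -> \bar R}) (T : X -> X) (r : nat) (A : 'I_r -> set X) : R :=
  limn (fun n : nat => join_entropy mu T A n / n%:R).

Definition is_symbolic_coding (X : Type) (r : nat) (A : 'I_r -> set X)
  (T : X -> X) (phi : X -> nat -> 'I_r) : Prop :=
  forall x j, A (phi x j) (iter j T x).

Definition prefix_word (r : nat) (om : nat -> 'I_r) (n : nat) : seq 'I_r :=
  mkseq om n.

Definition K_Z (R : realType) (r : nat) (Z : seq 'I_r -> seq bool)
  (om : nat -> 'I_r) : \bar R :=
  limn_esup (fun n : nat => ((size (Z (prefix_word om n)))%:R / n%:R : R)%:E).

Definition emp_freq {R : realType} (r : nat) (s : seq 'I_r) (l : nat)
  (w : l.-tuple 'I_r) : R :=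
  (\sum_(0 <= i < (size s - l).+1) (take l (drop i s) == val w : nat))%:R
  / ((size s - l).+1)%:R.

Definition emp_entropy {R : realType} (r : nat) (l : nat) (s : seq 'I_r) : R :=
  l%:R^-1 * \sum_(w : l.-tuple 'I_r) eta (emp_freq (R:=R) s w).

Definition optimal_coding (R : realType) (r : nat) (Z : seq 'I_r -> seq bool) : Prop :=
  forall k : nat, (0 < k)%N ->
    exists f : nat -> R,
      (fun n : nat => f n / n%:R) @ \oo --> (0 : R) /\
      forall s : seq 'I_r,
        (size (Z s))%:R / (size s)%:R <= emp_entropy k s + f (size s) / (size s)%:R.

(* Main.v *)
(**
Upper bound: by Birkhoff's theorem for indicators of cylinders, the empirical
entropy of order k along the orbit of almost every x tends to H_k / k, where
H_k is the entropy of the k-fold join; optimality gives K_Z <= H_k / k a.e.,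
for every k > 0.

Lower bound: suppose that |Z(w^n)| <= c n for all n >= N on a set F of positive
measure. By ergodicity, outside a set of measure < delta, every orbit enters F
before some fixed time M. Hence, up to measure delta, a word of length n
consists of fewer than M arbitrary letters followed by a word that Z codes
with at most c n bits. As Z is injective, there are at most
M r^M 2^(c n + 1) such words, so H_n / n <= c + delta log r + O(1/n).

With h = inf_n H_n / n, the two bounds together give H_n / n --> h (so neither
subadditivity of H_n nor the Shannon-McMillan-Breiman theorem is required) and
K_Z = h almost everywhere.
*)
Require Import Defs.
From HB Require Import structures.
From mathcomp Require Import all_boot all_order all_algebra.
From mathcomp Require Import all_classical all_reals all_analysis.
From mathcomp Require Import measurable_realfun.
From mathcomp Require Import lra zify.
Import Order.TTheory GRing.Theory Num.Theory.
Import numFieldNormedType.Exports.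
Local Open Scope classical_set_scope.
Local Open Scope ring_scope.

(* The imports above shadow [Defs.eta] by [HB.structures.eta]. *)
Local Notation eta := Defs.eta.

(** * Birkhoff's ergodic theorem for indicator functions *)

Section Birkhoff.
Context {d : measure_display} {X : measurableType d} {R : realType}.
Context (mu : probability X R) (T : X -> X).
Context (mT : measurable_fun [set: X] T) (inv : measure_invariant mu T).

Definition visits (B : set X) (n : nat) (x : X) : R :=
  \sum_(0 <= i < n) \1_B (iter i T x).

(** The largest Birkhoff sum of [g] over at most [n] terms, the empty sum included. Recursion along
    [T] makes the identity used in Garsia's argument hold by computation. *)
Fixpoint maxsum (g : X -> R) (n : nat) (x : X) : R :=
  if n is n'.+1 then Num.max 0 (g x + maxsum g n' (T x)) else 0.

Lemma maxsum_ge0 g n x : 0 <= maxsum g n x.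
Proof. by case: n => [|n] //=; rewrite le_max lexx. Qed.

Lemma maxsum_mono g n x : maxsum g n x <= maxsum g n.+1 x.
Proof.
elim: n x => [|n IHn] x; first exact: maxsum_ge0.
rewrite [X in X <= _]/= [X in _ <= X]/= ge_max !le_max lexx /= lerD2l.
by rewrite IHn orbT.
Qed.

Lemma maxsum_ge g n k x : (k <= n)%N ->
  \sum_(0 <= i < k) g (iter i T x) <= maxsum g n x.
Proof.
elim: n k x => [|n IHn] [|k] x // kn; try by rewrite big_geq ?maxsum_ge0.
rewrite big_nat_recl //= le_max; apply/orP; right; rewrite lerD2l.
by under eq_bigr do rewrite -iterS iterSr; exact: IHn.
Qed.

Lemma maxsum_le g n x : (forall y, g y <= 1) -> maxsum g n x <= n%:R.
Proof.
move=> g1; elim: n x => [|n IHn] x //=; rewrite ge_max ler0n /= -natr1 addrC.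
exact: lerD.
Qed.

Lemma measurable_iter n : measurable_fun [set: X] (iter n T).
Proof.
elim: n => [|n IHn]; first exact: measurable_id.
exact: (measurableT_comp mT IHn).
Qed.

Lemma measurable_maxsum g n : measurable_fun [set: X] g ->
  measurable_fun [set: X] (maxsum g n).
Proof.
move=> mg; elim: n => [|n IHn] /=; first exact: measurable_cst.
apply: measurable_maxr; first exact: measurable_cst.
exact: (measurable_funD mg (measurableT_comp IHn mT)).
Qed.

Lemma integral_invariant (f : X -> \bar R) : measurable_fun [set: X] f ->
  (forall x, 0 <= f x)%E -> (\int[mu]_x f (T x) = \int[mu]_x f x)%E.
Proof.
move=> mf f0; transitivity (\int[pushforward mu T]_x f x)%E.
  by rewrite ge0_integral_pushforward.
by apply: eq_measure_integral => B mB _; exact: inv.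
Qed.

(* Garsia's argument: on [0 < M_n] the maximum M_n of the partial sums of g
   satisfies M_n <= g + M_n \o T, and integrating against an invariant
   measure cancels the two maxima. *)
Lemma maximal_inequality (B : set X) (c : R) (n : nat) : measurable B -> 0 <= c ->
  (c%:E * mu [set x | 0 < maxsum (fun y => \1_B y - c) n x]%R <= mu B)%E.
Proof.
move=> mB c0; set g := (fun y => \1_B y - c); set M := maxsum g n; set E := [set x | _].
have mg : measurable_fun [set: X] g.
  by apply: measurable_funB; [exact: measurable_indic|exact: measurable_cst].
have mM : measurable_fun [set: X] M by exact: measurable_maxsum.
have mE : measurable E.
  rewrite (_ : E = [set: X] `&` M @^-1` `]0, +oo[); first exact: mM.
  by apply/seteqP; split => x /=; rewrite in_itv /= andbT // => -[].
have mM' : measurable_fun [set: X] (EFin \o M) by exact/measurable_EFinP.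
(* Finiteness is what allows the integral of [M] to be cancelled once invariance has identified it
   with that of [M \o T]. *)
have I_fin : (\int[mu]_x (M x)%:E)%E \is a fin_num.
  rewrite ge0_fin_numE; last first.
    by apply: integral_ge0 => x _; rewrite lee_fin maxsum_ge0.
  apply: (@le_lt_trans _ _ (\int[mu]_x (n%:R)%:E)%E); last first.
    by rewrite integral_cst //= probability_setT mule1 ltry.
  apply: ge0_le_integral => //.
  + by move=> x _; rewrite lee_fin maxsum_ge0.
  + move=> x _; rewrite lee_fin; apply: maxsum_le => y.
    by rewrite /g indicE; case: (_ \in _) => /=; lra.
have key x : M x + c * \1_E x <= \1_B x + M (T x).
  have [Ex|Ex] := pselect (E x); rewrite [\1_E x]indicE; last first.
    rewrite (memNset Ex) mulr0 addr0.
    have /le_trans-> // : M x <= 0 by move: Ex => /negP; rewrite /E /= -/(M x) -leNgt.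
    by rewrite addr_ge0 ?maxsum_ge0 // indicE.
  rewrite (mem_set Ex) /=; move: Ex; rewrite /E /= /M; case: (n) => [|k] /=.
    by rewrite ltxx.
  rewrite lt_max ltxx /= => g0; rewrite max_r ?(ltW g0) //.
  have := maxsum_mono g k (T x); rewrite /= /g; lra.
rewrite -(leeD2lE _ _ I_fin) [leRHS]addeC.
rewrite -[in X in (_ <= X)%E]integral_invariant //; last first.
  by move=> x; rewrite lee_fin maxsum_ge0.
have -> : (mu B = \int[mu]_x (\1_B x)%:E)%E by rewrite integral_indic // setIT.
have -> : (c%:E * mu E = \int[mu]_x (c%:E * (\1_E x)%:E))%E.
  rewrite ge0_integralZl_EFin // ?integral_indic ?setIT //.
  exact/measurable_EFinP/measurable_indic.
have mcE : measurable_fun [set: X] (fun x => c%:E * (\1_E x)%:E)%E.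
  apply: measurable_funeM; exact/measurable_EFinP/measurable_indic.
have mB' : measurable_fun [set: X] (fun x => (\1_B x : R)%:E).
  exact/measurable_EFinP/measurable_indic.
have mMT : measurable_fun [set: X] (fun x => (M (T x))%:E).
  exact: (measurableT_comp mM' mT).
rewrite -ge0_integralD //; last first.
- by move=> x _; rewrite mule_ge0 // lee_fin.
- by move=> x _; rewrite lee_fin maxsum_ge0.
rewrite -ge0_integralD //; last first.
  by move=> x _; rewrite lee_fin maxsum_ge0.
apply: ge0_le_integral => //.
- by move=> x _; rewrite adde_ge0 ?mule_ge0 // lee_fin ?maxsum_ge0.
- exact: emeasurable_funD.
- exact: emeasurable_funD.
- by move=> x _; rewrite -!EFinM -!EFinD lee_fin; exact: key.
Qed.
Context (erg : measure_ergodic mu T).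

(** The points where the sums of [\1_B - c] are unbounded above form an invariant set. Were it of
    full measure, the maximal inequality would give [c <= mu B] in the limit; by ergodicity it is
    therefore null. *)
Lemma visits_ae_bounded (B : set X) (c : R) : measurable B -> fine (mu B) < c ->
  {ae mu, forall x, exists K : nat, forall n, visits B n x <= c * n%:R + K%:R}.
Proof.
move=> mB Bc; pose g y : R := \1_B y - c.
have muB : mu B = (fine (mu B))%:E by rewrite fineK // fin_num_measure.
have c0 : 0 < c by apply: le_lt_trans Bc; exact: fine_ge0.
have mg : measurable_fun [set: X] g.
  by apply: measurable_funB; [exact: measurable_indic|exact: measurable_cst].
pose S n x : R := \sum_(0 <= i < n) g (iter i T x).
have SE n x : S n x = visits B n x - c * n%:R.
  by rewrite /S /visits sumrB big_const_nat subn0 iter_addr_0 mulr_natr.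
have SS n x : S n.+1 x = g x + S n (T x).
  rewrite /S big_nat_recl //=; congr (_ + _).
  by apply: eq_bigr => i _; rewrite -iterS iterSr.
have mS n : measurable_fun [set: X] (S n).
  apply: measurable_sum => i; exact: (measurableT_comp mg (measurable_iter i)).
pose G := [set x | forall K : nat, exists n, K%:R < S n x].
have mgt f (a : R) : measurable_fun [set: X] f -> measurable [set x | a < f x].
  move=> mf; rewrite (_ : [set x | _] = [set: X] `&` f @^-1` `]a, +oo[).
    exact: mf.
  by apply/seteqP; split => x /=; rewrite in_itv /= andbT // => -[].
have mG : measurable G.
  rewrite (_ : G = \bigcap_K \bigcup_n [set x | K%:R < S n x]).
    apply: bigcapT_measurable => K; apply: bigcupT_measurable => n; exact: mgt.
  apply/seteqP; split => x Gx.
  - by move=> K _; have [n Kn] := Gx K; exists n.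
  - by move=> K; have [n _ Kn] := Gx K I; exists n.
(* Passing from [x] to [T x] drops one term, between [-c] and 1; the thresholds chosen for [K] below
   absorb it. *)
have g1 y : -c <= g y <= 1 by rewrite /g indicE; case: (_ \in _) => /=; lra.
have TG : T @^-1` G = G.
  apply/seteqP; split => x Gx K.
  - have [n Kn] := Gx (Num.truncn (K%:R + c)).+1.
    exists n.+1; rewrite SS; have := truncnS_gt (K%:R + c).
    by move: Kn (g1 x) => /=; lra.
  - have [[|n]] := Gx K.+1; first by rewrite /S big_geq // ltrn0.
    rewrite SS -natr1 => Kn; exists n.
    by move: Kn (g1 x) => /=; lra.
have muG : mu G = 0%E.
  have [//|G1] := erg _ mG TG.
  pose E n := [set x | 0 < maxsum g n x].
  have mE n : measurable (E n) by apply: mgt; exact: measurable_maxsum.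
  have ndE : {homo E : n m / (n <= m)%N >-> (n <= m)%O}.
    apply: homo_leq => //; first by move=> ? ? ?; exact: le_trans.
    by move=> n; apply/subsetPset => x /lt_le_trans; apply; exact: maxsum_mono.
  have mUE : measurable (\bigcup_n E n) by exact: bigcupT_measurable.
  have GE : G `<=` \bigcup_n E n.
    move=> x /(_ 0%N) [n Sn]; exists n => //.
    exact: lt_le_trans Sn (maxsum_ge g n n x (leqnn n)).
  have UE1 : mu (\bigcup_n E n) = 1%E.
    apply/eqP; rewrite eq_le probability_le1 //= -G1.
    by apply: le_measure => //; rewrite inE.
  have cE : mu (E n) @[n --> \oo] --> 1%E.
    by rewrite -UE1; exact: nondecreasing_cvg_mu.
  suff : (1 <= (fine (mu B) / c)%:E :> \bar R)%E.
    by rewrite lee_fin ler_pdivlMr // mul1r leNgt Bc.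
  rewrite -(cvg_lim _ cE) //; apply: lime_le; first by apply/cvg_ex; exists 1%E.
  apply: nearW => n /=; rewrite EFinM muleC.
  rewrite lee_pdivlMl // -muB.
  apply: maximal_inequality => //; exact: ltW.
exists G; split=> // x /= nx K; apply: contrapT => nK; apply: nx; exists K => n.
rewrite leNgt; apply/negP => Kn; apply: nK; exists n.
by rewrite SE; move: Kn; lra.
Qed.

Lemma visits_setC (B : set X) n x : visits (~` B) n x = n%:R - visits B n x.
Proof.
apply/eqP; rewrite eq_sym subr_eq -big_split /=.
rewrite (eq_bigr (fun=> 1)) ?big_const_nat ?subn0 ?iter_addr_0 // => i _.
by rewrite !indicE in_setC; case: (_ \in _); rewrite /= ?addr0 ?add0r.
Qed.

(** The one-sided bound for [B] limits the visit frequency from above; for the complement of [B] it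
    limits it from below. *)
Lemma birkhoff_indic (B : set X) : measurable B ->
  {ae mu, forall x, visits B n x / n%:R @[n --> \oo] --> fine (mu B)}.
Proof.
move=> mB.
have up C : measurable C -> {ae mu, forall x, forall m : nat, exists K : nat, forall n,
    visits C n x <= (fine (mu C) + m.+1%:R^-1) * n%:R + K%:R}.
  move=> mC; apply: ae_foralln => m; apply: visits_ae_bounded => //.
  by rewrite ltrDl invr_gt0.
apply: filterS2 (up _ mB) (up _ (measurableC mB)) => x Bx Cx.
have muC : fine (mu (~` B)) = 1 - fine (mu B).
  by rewrite probability_setC // fineB // fin_num_measure.
apply/cvgrPdist_le => e e0.
(* Half of [e] pays for the excess [m.+1%:R^-1], the other half for the constants [K1] and [K2]
   divided by [n]. *)
have [m me] : exists m : nat, m.+1%:R^-1 <= e / 2.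
  exists (Num.truncn (e / 2)^-1); rewrite -[leRHS]invrK lef_pV2 ?posrE ?invr_gt0 ?divr_gt0 //.
  by apply: ltW; exact: truncnS_gt.
have [K1 BK] := Bx m; have [K2 CK] := Cx m.
near=> n.
have n0 : 0 < n%:R :> R by rewrite ltr0n; near: n; exact: nbhs_infty_gt.
have Ke : (K1 + K2)%:R <= (e / 2) * n%:R.
  rewrite -ler_pdivrMl ?divr_gt0 //; near: n; exact: nbhs_infty_ger.
have mn : m.+1%:R^-1 * n%:R <= (e / 2) * n%:R by rewrite ler_pM2r.
have := BK n; have := CK n; rewrite visits_setC muC => Cn Bn.
have K10 : 0 <= K1%:R :> R by []. have K20 : 0 <= K2%:R :> R by [].
rewrite natrD in Ke; set b := fine (mu B) in Bn Cn *; set v := visits B n x in Bn Cn *.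
clear BK CK me muC Bx Cx up.
move: (m.+1%:R^-1) (n%:R) (K1%:R) (K2%:R) n0 Bn Cn Ke mn K10 K20 => q t k1 k2 *.
have up1 : v / t <= b + e by rewrite ler_pdivrMr //; lra.
have lo1 : b - e <= v / t by rewrite ler_pdivlMr //; lra.
by rewrite ler_norml; apply/andP; split; lra.
Unshelve. all: by end_near. Qed.

End Birkhoff.

(** * The function -p log p and the entropy of a group of outcomes *)

Section Entropy.
Context {R : realType}.
Implicit Types p q : R.

Let ln2_gt0 : 0 < ln 2 :> R. Proof. by rewrite ln_gt0 // ltr1n. Qed.

Lemma etaE p : eta p = - (p * log2 p).
Proof. by rewrite /eta; case: ifPn => [/eqP->|//]; rewrite mul0r oppr0. Qed.

Lemma eta_ge0 p : 0 <= p <= 1 -> 0 <= eta p.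
Proof.
move=> /andP[p0 p1]; rewrite etaE -mulrN mulr_ge0 // oppr_ge0.
by rewrite pmulr_lle0 ?invr_gt0 // ln_le0.
Qed.

(** One term of Gibbs' inequality, from ln t <= t - 1 at t = q / p. The corrections cancel upon
    summation when the [p] and the [q] have equal totals. *)
Lemma eta_le_cross p q : 0 <= p -> 0 < q ->
  eta p <= - (p * log2 q) + (q - p) / ln 2.
Proof.
move=> p0 q0; rewrite etaE; move: p0; rewrite le0r => /orP[/eqP->|p0].
  by rewrite !mul0r oppr0 add0r addr0 divr_ge0 // ltW.
suff : p * (ln q - ln p) <= q - p.
  rewrite -(ler_pM2r (_ : 0 < (ln 2)^-1)) ?invr_gt0 // /log2; lra.
rewrite -ln_div ?posrE // -[q / p](addrNK 1) addrC.
have /le_ln1Dx : -1 < q / p - 1 by rewrite -subr_gt0 opprK subrK divr_gt0.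
by rewrite -(ler_pM2l p0) mulrBr mulr1 mulrCA divff ?gt_eqF // mulr1.
Qed.

Lemma eta_le p : 0 <= p -> eta p <= (ln 2)^-1.
Proof.
move=> p0; apply: le_trans (eta_le_cross _ _ p0 ltr01) _.
by rewrite /log2 ln1 mul0r mulr0 oppr0 add0r ler_piMl ?invr_ge0 ?(ltW ln2_gt0) //; lra.
Qed.

(** With q = sqrt p the cross term is half of [eta p] and is absorbed on the left. This bound yields
    continuity of [eta] at 0, where the logarithm is of no help. *)
Lemma eta_le_sqrt p : 0 <= p -> eta p <= 2 * Num.sqrt p / ln 2.
Proof.
move=> p0; move: (p0); rewrite le0r => /orP[/eqP->|p1].
  by rewrite /eta eqxx mulr_ge0 ?mulr_ge0 ?sqrtr_ge0 // invr_ge0 ltW.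
have s0 : 0 < Num.sqrt p by rewrite sqrtr_gt0.
have := eta_le_cross _ _ p0 s0.
have -> : log2 (Num.sqrt p) = log2 p / 2.
  rewrite -{2}(sqr_sqrtr p0) /log2 lnXn //.
  by rewrite -mulr_natr; move: (ln (2 : R))^-1 => b; lra.
rewrite etaE mulrBl -mulrA.
have : 0 <= p / ln 2 by rewrite divr_ge0 // ltW.
by move: (p / ln 2) (Num.sqrt p / ln 2) => a b; lra.
Qed.

Lemma cvg_eta (u : nat -> R) p : (forall n, 0 <= u n) ->
  u n @[n --> \oo] --> p -> eta (u n) @[n --> \oo] --> eta p.
Proof.
move=> u0 up; have : 0 <= p.
  by rewrite -(cvg_lim _ up) //; apply: limr_ge; [exact: cvgP up|exact: nearW].
rewrite le0r => /orP[/eqP p0|p0].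
  rewrite p0 in up *; rewrite {2}/eta eqxx.
  apply: (@squeeze_cvgr _ _ _ _ (fun=> 0) (fun n => 2 * Num.sqrt (u n) / ln 2)).
  - have : \forall n \near \oo, u n < 1.
      by apply: (cvgr_lt _ up); exact: ltr01.
    apply: filterS => n un1; rewrite eta_ge0 ?eta_le_sqrt //.
    by rewrite u0 ltW.
  - exact: cvg_cst.
  - have : 2 * Num.sqrt (u n) / ln 2 @[n --> \oo] --> (2 * Num.sqrt 0 / ln 2 : R).
      apply: cvgM; last exact: cvg_cst.
      apply: cvgM; first exact: cvg_cst.
      exact: (continuous_cvg _ (@sqrt_continuous R _) up).
    by rewrite sqrtr0 mulr0 mul0r.
under eq_cvg do rewrite etaE; rewrite etaE.
apply: cvgN; apply: cvgM => //; apply: cvgM; last exact: cvg_cst.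
exact: (continuous_cvg _ (continuous_ln p0) up).
Qed.

(** Gibbs' inequality against the uniform distribution of the same total mass: for given mass, equal
    shares maximise the entropy. *)
Lemma entropy_group (I : finType) (P : pred I) (p : I -> R) :
  (forall i, 0 <= p i) ->
  \sum_(i | P i) eta (p i) <= eta (\sum_(i | P i) p i) +
    (\sum_(i | P i) p i) * log2 #|P|%:R.
Proof.
move=> p0; set s := \sum_(i | P i) p i.
have : 0 <= s by exact: sumr_ge0.
rewrite le0r => /orP[s0|s0].
  rewrite (eqP s0) /eta eqxx mul0r addr0 big1 // => i Pi; rewrite ifT //.
  by move: s0; rewrite psumr_eq0 // => /allP/(_ i); rewrite mem_index_enum Pi; apply.
have P0 : 0 < #|P|%:R :> R.
  rewrite ltr0n lt0n; apply: contraTneq s0 => /card0_eq P0.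
  by rewrite /s big_pred0 ?ltxx // => i; rewrite -(P0 i).
set q := s / #|P|%:R.
have q0 : 0 < q by exact: divr_gt0.
apply: (@le_trans _ _ (\sum_(i | P i) (- (p i * log2 q) + (q - p i) / ln 2))).
  by apply: ler_sum => i _; exact: eta_le_cross.
rewrite big_split /= sumrN -!mulr_suml sumrB sumr_const -/s.
rewrite -[q *+ _]mulr_natr divfK ?gt_eqF // subrr mul0r addr0 etaE.
by rewrite /log2 /q ln_div ?posrE //; lra.
Qed.

End Entropy.

(** * Upper limits and eventual bounds *)

Section LimnEsup.
Context {R : realType}.
Implicit Types (u : nat -> \bar R) (c : \bar R).

Lemma limn_esup_le u c : (\forall n \near \oo, (u n <= c)%E) -> (limn_esup u <= c)%E.
Proof.
move=> uc; apply: ge_ereal_inf.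
exists (ereal_sup (u @` [set n | (u n <= c)%E])); first by exists [set n | (u n <= c)%E].
by apply: ge_ereal_sup => _ [n nc <-].
Qed.

Lemma limn_esup_lt u c : (limn_esup u < c)%E -> \forall n \near \oo, (u n <= c)%E.
Proof.
move=> /ereal_inf_lt[_ [V V_oo <-] Vc]; apply: filterS V_oo => n Vn.
by apply: le_trans (ltW Vc); apply: ereal_sup_ubound; exists n.
Qed.

End LimnEsup.

(** * Symbolic coding, cylinders and words *)

Section Symbolic.
Context {d : measure_display} {X : measurableType d} {R : realType}.
Context (mu : probability X R) (T : X -> X) (mT : measurable_fun [set: X] T).
Context {r : nat} (A : 'I_r -> set X) (hA : measurable_partition A).
Context (phi : X -> nat -> 'I_r) (hphi : is_symbolic_coding A T phi).

(** Disjointness of the cells leaves one possible symbol; the shift law and the description of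
    cylinders as fibres of [word] rest on this. *)
Lemma coding_uniq x j i : A i (iter j T x) -> phi x j = i.
Proof.
move=> Ai; apply/eqP/negP => /negP /(hA.2.1 _ _) /seteqP[+ _].
by move=> /(_ (iter j T x)); apply; split => //; exact: hphi.
Qed.

Lemma coding_iter x j k : phi (iter j T x) k = phi x (k + j).
Proof. by apply/esym/coding_uniq; rewrite iterD; exact: hphi. Qed.

Definition word n (x : X) : n.-tuple 'I_r := [tuple phi x i | i < n].

Lemma val_word n x : val (word n x) = prefix_word (phi x) n.
Proof. by rewrite /= /prefix_word /mkseq -val_enum_ord -map_comp. Qed.

Lemma cylinderE n (w : n.-tuple 'I_r) : cylinder A T w = [set x | word n x = w].
Proof.
apply/seteqP; split => x; rewrite /cylinder /=.
- move=> Ax; apply: eq_from_tnth => i; rewrite tnth_mktuple.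
  by apply: coding_uniq; exact: Ax.
- by move=> <- i _; rewrite /= tnth_mktuple; exact: hphi.
Qed.

Lemma measurable_cylinder n (w : n.-tuple 'I_r) : measurable (cylinder A T w).
Proof.
apply: fin_bigcap_measurable => // i _; rewrite -[X in measurable X]setTI.
exact: (measurable_iter T mT i) (hA.1 _).
Qed.

Lemma word_bigcup n (Q : pred (n.-tuple 'I_r)) :
  [set x | Q (word n x)] = \bigcup_(w in [set` Q]) cylinder A T w.
Proof.
apply/seteqP; split => x /=; first by exists (word n x) => //; rewrite cylinderE.
by move=> [w Qw]; rewrite cylinderE /= => ->.
Qed.

Lemma measurable_word n (Q : pred (n.-tuple 'I_r)) :
  measurable [set x | Q (word n x)].
Proof.
rewrite word_bigcup; apply: fin_bigcup_measurable => // w _.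
exact: measurable_cylinder.
Qed.

(** Cylinders are fibres of [word n], hence pairwise disjoint, and finite additivity applies. *)
Lemma sum_cylinder n (Q : pred (n.-tuple 'I_r)) :
  \sum_(w | Q w) fine (mu (cylinder A T w)) = fine (mu [set x | Q (word n x)]).
Proof.
rewrite word_bigcup measure_fin_bigcup //=; last 2 first.
- move=> w w' _ _ [x]; rewrite !cylinderE /=; by move=> [-> ->].
- by move=> w _; exact: measurable_cylinder.
rewrite [LHS]sum_fine; last first.
  by move=> w _; rewrite fin_num_measure //; exact: measurable_cylinder.
congr fine; apply: bigfs; first exact: index_enum_uniq.
by move=> w _; rewrite mem_index_enum.
Qed.

Lemma take_prefix_word k n x :
  take k (prefix_word (phi x) n) = prefix_word (phi x) (minn k n).
Proof. by rewrite /prefix_word /mkseq -map_take take_iota. Qed.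

Lemma drop_prefix_word j n x :
  drop j (prefix_word (phi x) n) = prefix_word (phi (iter j T x)) (n - j).
Proof.
rewrite /prefix_word /mkseq -map_drop drop_iota addnC iotaDl -map_comp.
by apply: eq_map => i /=; rewrite coding_iter addnC.
Qed.

(** The window at position [i] reads [w] exactly when the orbit is in the cylinder at time [i].
    Length [n + k] gives exactly [n.+1] windows and avoids truncated subtraction. *)
Lemma emp_freq_visits n k (w : k.-tuple 'I_r) x :
  emp_freq (prefix_word (phi x) (n + k)) w =
  visits T (cylinder A T w) n.+1 x / n.+1%:R :> R.
Proof.
rewrite /emp_freq size_mkseq addnK natr_sum; congr (_ / _).
apply: eq_big_nat => i /andP[_ ilt]; rewrite indicE; congr (_%:R); congr nat_of_bool.
rewrite drop_prefix_word take_prefix_word (minn_idPl _) -?val_word; last by lia.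
rewrite cylinderE; apply/eqP/idP => [/val_inj E|/set_mem E]; first exact: mem_set.
exact: (congr1 val E).
Qed.

End Symbolic.

(** * Counting words that have a short code *)

Section Counting.
Local Open Scope nat_scope.

(* The terminating [true] makes the zero-padding reversible. *)
Lemma pad_inj (m : nat) (s t : seq bool) : size s <= m -> size t <= m ->
  (forall i : 'I_m.+1, nth false (rcons s true) i = nth false (rcons t true) i) ->
  s = t.
Proof.
have aux s' t' : size s' <= m -> size t' <= m ->
    (forall i : 'I_m.+1, nth false (rcons s' true) i = nth false (rcons t' true) i) ->
    size t' <= size s'.
  move=> sm tm st; rewrite leqNgt; apply/negP => st'.
  have := st (inord (size t')); rewrite inordK // nth_default ?size_rcons //.
  by rewrite nth_rcons ltnn eqxx.
move=> sm tm st; have sz : size s = size t.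
  by apply/eqP; rewrite eqn_leq !aux // => i; rewrite st.
apply: (@eq_from_nth _ false) => // i si.
have im : i < m.+1 by lia.
by have := st (Ordinal im); rewrite /= !nth_rcons -sz si.
Qed.

(** For fixed [j], the first [M] letters and the code of [drop j w] determine [w], by injectivity of
    [Z]. The exponent [m.+1] leaves room for the terminating bit of the padding; the factor [M] is
    the union bound over [j]. *)
Lemma card_short_words (F : finType) (Z : seq F -> seq bool) (L M m : nat) :
  injective Z -> M <= L ->
  #|[pred w : L.-tuple F | [exists j : 'I_M, size (Z (drop j w)) <= m]]|
    <= M * (#|F| ^ M * 2 ^ m.+1).
Proof.
move=> Zinj ML; pose P (j : 'I_M) := [pred w : L.-tuple F | size (Z (drop j w)) <= m].
have cardP j : #|P j| <= #|F| ^ M * 2 ^ m.+1.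
  pose f (w : L.-tuple F) : {ffun 'I_M -> F} * {ffun 'I_m.+1 -> bool} :=
    ([ffun i : 'I_M => tnth w (widen_ord ML i)],
     [ffun i : 'I_m.+1 => nth false (rcons (Z (drop j w)) true) i]).
  have <- : #|{: {ffun 'I_M -> F} * {ffun 'I_m.+1 -> bool}}| = #|F| ^ M * 2 ^ m.+1.
    by rewrite card_prod !card_ffun !card_ord card_bool.
  apply: (@leq_card_in _ _ f) => w w' /= wP w'P [/ffunP take_eq /ffunP Z_eq].
  have drop_eq : drop j w = drop j w'.
    apply: Zinj; apply: (pad_inj _ _ _ wP w'P) => i.
    by have := Z_eq i; rewrite !ffunE.
  apply: eq_from_tnth => i; have x0 := tnth w i.
  have [ij|ji] := ltnP i j.
    have iM : i < M by exact: ltn_trans ij _.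
    have := take_eq (Ordinal iM); rewrite !ffunE.
    by rewrite (_ : widen_ord _ _ = i) //; exact: val_inj.
  by rewrite !(tnth_nth x0) -(subnKC ji) -!nth_drop drop_eq.
apply: (@leq_trans (\sum_(j < M) #|P j|)).
  rewrite -sum1_card big_mkcond /=.
  under [leqRHS]eq_bigr do rewrite -sum1_card big_mkcond.
  rewrite exchange_big /=; apply: leq_sum => w _.
  rewrite inE; case: existsP => // -[j wj].
  by rewrite (bigD1 j) //= inE wj.
apply: (@leq_trans (\sum_(j < M) (#|F| ^ M * 2 ^ m.+1))); first exact: leq_sum.
by rewrite sum_nat_const card_ord.
Qed.

End Counting.

(** * Logarithms in base two *)

Section Log2.
Context {R : realType}.

Lemma log2_natr_ge0 (n : nat) : 0 <= log2 (n%:R : R).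
Proof.
case: n => [|n]; first by rewrite /log2 ln0 // mul0r.
by rewrite divr_ge0 // ln_ge0 // ler1n.
Qed.

Lemma ler_log2_natr (a b : nat) : (a <= b)%N -> log2 (a%:R : R) <= log2 b%:R.
Proof.
(* By convention [ln 0 = 0], so monotonicity extends to [a = 0]. *)
case: a => [|a] ab; first by rewrite [leLHS]/log2 ln0 // mul0r log2_natr_ge0.
rewrite ler_pM2r ?invr_gt0 ?ln_gt0 ?ltr1n // ler_ln ?posrE ?ltr0n ?ler_nat //; lia.
Qed.

Lemma log2M (a b : R) : 0 < a -> 0 < b -> log2 (a * b) = log2 a + log2 b.
Proof. by move=> a0 b0; rewrite /log2 lnM ?posrE // mulrDl. Qed.

Lemma log2X (a : R) n : 0 < a -> log2 (a ^+ n) = n%:R * log2 a.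
Proof. by move=> a0; rewrite /log2 lnXn // -[ln a *+ n]mulr_natl mulrA. Qed.

Lemma log22 : log2 (2 : R) = 1.
Proof.
have l2 : 0 < ln (2 : R) by rewrite ln_gt0 // ltr1n.
by rewrite /log2 divff // gt_eqF.
Qed.

End Log2.

(** * The two bounds on the compression rate *)

Section Coding.
Context {d : measure_display} {X : measurableType d} {R : realType}.
Context (mu : probability X R) (T : X -> X) (mT : measurable_fun [set: X] T).
Context (inv : measure_invariant mu T) (erg : measure_ergodic mu T).
Context {r : nat} (A : 'I_r -> set X) (hA : measurable_partition A).
Context (phi : X -> nat -> 'I_r) (hphi : is_symbolic_coding A T phi).

Let cyl_ge0 n (w : n.-tuple 'I_r) : 0 <= fine (mu (cylinder A T w)).
Proof. exact: fine_ge0. Qed.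

Lemma join_entropy_ge0 n : 0 <= join_entropy mu T A n.
Proof.
apply: sumr_ge0 => w _; apply: eta_ge0; rewrite cyl_ge0 /=.
have mw := measurable_cylinder T mT A hA _ w.
by rewrite -lee_fin fineK ?probability_le1 // fin_num_measure.
Qed.

(** Birkhoff's theorem holds simultaneously for the finitely many cylinders of length [k], and [eta]
    preserves the limits. *)
Lemma emp_entropy_cvg k : {ae mu, forall x,
  emp_entropy k (prefix_word (phi x) n) @[n --> \oo] -->
  join_entropy mu T A k / k%:R}.
Proof.
have : {ae mu, forall x, forall w : k.-tuple 'I_r,
    visits T (cylinder A T w) n x / n%:R @[n --> \oo] --> fine (mu (cylinder A T w))}.
  apply: filter_forall => w; apply: birkhoff_indic => //.
  exact: measurable_cylinder.
apply: filterS => x Bx; rewrite mulrC; apply: cvgM; first exact: cvg_cst.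
apply: cvg_big; [exact: add_continuous|move=> w _].
have : emp_freq (R := R) (prefix_word (phi x) n) w @[n --> \oo] --> fine (mu (cylinder A T w)).
  rewrite -(cvg_shiftn k).
  under eq_cvg do rewrite /= (emp_freq_visits T A hA phi hphi).
  by have := Bx w; rewrite -cvg_shiftS.
apply: cvg_eta => n; exact: divr_ge0.
Qed.

Lemma K_Z_le (Z : seq 'I_r -> seq bool) k : (0 < k)%N -> optimal_coding R Z ->
  {ae mu, forall x, (K_Z R Z (phi x) <= (join_entropy mu T A k / k%:R)%:E)%E}.
Proof.
move=> k0 /(_ _ k0)[f [f0 Zf]]; apply: filterS (emp_entropy_cvg k) => x Hx.
have lim_bound : emp_entropy k (prefix_word (phi x) n) + f n / n%:R @[n --> \oo] -->
    join_entropy mu T A k / k%:R.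
  by rewrite -[X in _ --> X]addr0; exact: cvgD Hx f0.
apply/lee_addgt0Pr => e e0; apply: limn_esup_le; rewrite -EFinD.
have : \forall n \near \oo, emp_entropy k (prefix_word (phi x) n) + f n / n%:R <
    join_entropy mu T A k / k%:R + e.
  by apply: (cvgr_lt _ lim_bound); rewrite ltrDl.
apply: filterS => n /ltW /(le_trans _) le_n; rewrite lee_fin; apply: le_n.
by have := Zf (prefix_word (phi x) n); rewrite size_mkseq.
Qed.

(** Fixing [N] makes this a countable intersection of conditions on finite words, hence measurable;
    the union over [N] contains every point with [K_Z] below [c]. *)
Definition compressed (Z : seq 'I_r -> seq bool) (c : R) (N : nat) : set X :=
  [set x | forall n, (N <= n)%N -> (size (Z (prefix_word (phi x) n)))%:R <= c * n%:R].

Lemma measurable_compressed Z c N : measurable (compressed Z c N).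
Proof.
pose Q n (w : n.-tuple 'I_r) := (N <= n)%N ==> ((size (Z w))%:R <= c * n%:R).
rewrite (_ : compressed Z c N = \bigcap_n [set x | Q n (word phi n x)]).
  apply: bigcapT_measurable => n.
  exact: (measurable_word T mT A hA phi hphi n (Q n)).
apply/seteqP; split => x /=.
- by move=> xF n _; apply/implyP => Nn; rewrite val_word; exact: xF.
- by move=> xF n Nn; have /implyP /(_ Nn) := xF n I; rewrite val_word.
Qed.

Lemma ae_visits_sweep (F : set X) (delta : R) : measurable F -> (0 < mu F)%E ->
  0 < delta -> exists M : nat, 1 - delta <
    fine (mu (\bigcup_(j in [set j | (j < M.+1)%N]) (iter j T @^-1` F))).
Proof.
move=> mF F0 delta0.
pose U M := \bigcup_(j in [set j | (j < M.+1)%N]) (iter j T @^-1` F).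
have mpre j : measurable (iter j T @^-1` F).
  by rewrite -[X in measurable X]setTI; exact: (measurable_iter T mT j).
have mU M : measurable (U M) by apply: bigcup_measurable => j _.
have mUU : measurable (\bigcup_M U M) by exact: bigcupT_measurable.
have ndU : {homo U : n m / (n <= m)%N >-> (n <= m)%O}.
  move=> n m nm; apply/subsetPset => x [j /= jn Fx]; exists j => //=; lia.
have U1 : mu (\bigcup_M U M) = 1%E.
  have : {ae mu, forall x, (\bigcup_M U M) x}.
    (* An orbit that never enters [F] has visit frequency 0, not [mu F]. *)
    apply: filterS (birkhoff_indic mu T mT inv erg F mF) => x Bx.
    apply: contrapT => nUx; suff : fine (mu F) = 0.
      by apply/eqP; rewrite gt_eqF // fine_gt0 // F0 ltey_eq fin_num_measure.
    rewrite -(cvg_lim _ Bx) //; apply: lim_near_cst => //; apply: nearW => n.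
    rewrite /visits big1 ?mul0r // => j _; rewrite indicE memNset // => Fj.
    by apply: nUx; exists j => //; exists j => /=.
  move=> UU_ae; have : mu (~` \bigcup_M U M) = 0%E.
    by apply: measure_negligible; [exact: measurableC|exact: UU_ae].
  rewrite probability_setC // => /eqP; rewrite sube_eq ?fin_num_measure //.
  by rewrite add0e => /eqP.
have cU : mu (U M) @[M --> \oo] --> 1%E.
  by rewrite -U1; exact: nondecreasing_cvg_mu.
have cU' : fine (mu (U M)) @[M --> \oo] --> (1 : R) by exact: fine_cvg.
have [M _ /(_ M (leqnn M))] : \forall M \near \oo, 1 - delta < fine (mu (U M)).
  by apply: (cvgr_gt _ cU'); rewrite ltrBlDr ltrDl.
by exists M.
Qed.

Lemma compressed_join_entropy Z c N e : injective Z ->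
  (0 < mu (compressed Z c N))%E -> 0 < e ->
  \forall n \near \oo, join_entropy mu T A n / n%:R <= c + e.
Proof.
move=> Zinj F0 e0; set F := compressed Z c N in F0.
have mF : measurable F by exact: measurable_compressed.
have [x0 Fx0] : F !=set0 by apply/set0P; apply: contraTneq F0 => ->; rewrite measure0 ltxx.
have c0 : 0 <= c.
  have := Fx0 N.+1 (leqnSn N) => /(le_trans (ler0n _ _)).
  by rewrite pmulr_lge0 // ltr0n.
have r0 : (0 < r)%N by apply: leq_ltn_trans (ltn_ord (phi x0 0)).
set lr : R := log2 r%:R.
have lr0 : 0 <= lr by exact: log2_natr_ge0.
(* Chosen so that [delta * lr <= e / 2]; the added 1 keeps the denominator positive when [r = 1]. *)
pose delta := e / (2 * (lr + 1)).
have delta0 : 0 < delta by rewrite divr_gt0 // mulr_gt0 // ltr_wpDl.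
have delta_lr : delta * lr <= e / 2.
  have : delta * (lr + 1) = e / 2 by rewrite /delta invfM mulrA divfK // gt_eqF // ltr_wpDl.
  by move: delta0; rewrite mulrDr mulr1; lra.
have [M] := ae_visits_sweep F delta mF F0 delta0; set U := \bigcup_(j in _) _ => Udelta.
have mU : measurable U.
  apply: bigcup_measurable => j _; rewrite -[X in measurable X]setTI.
  exact: (measurable_iter T mT j).
(* The cost independent of [n]: the [eta] of the two group masses, the choice of entry time and
   first letters, and 1 from [m.+1]. *)
pose C : R := 2 / ln 2 + log2 (M.+1 * r ^ M.+1)%:R + 1.
near=> n.
(* This leaves at least [N] letters after any entry time [j <= M], so the bound defining [F] applies
   to the remaining word. *)
have NMn : (N + M.+1 <= n)%N by near: n; exact: nbhs_infty_ge.
have n0 : 0 < n%:R :> R by rewrite ltr0n; lia.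
have Cn : C <= (e / 2) * n%:R.
  rewrite -ler_pdivrMl ?divr_gt0 //; near: n; exact: nbhs_infty_ger.
pose m := Num.truncn (c * n%:R).
have cn0 : 0 <= c * n%:R by rewrite mulr_ge0 // ltW.
have mcn : m%:R <= c * n%:R by rewrite truncn_le.
pose Q := [pred w : n.-tuple 'I_r | [exists j : 'I_M.+1, (size (Z (drop j w)) <= m)%N]].
have UQ : U `<=` [set x | Q (word phi n x)].
  move=> x [j /= jM Fjx]; apply/existsP; exists (Ordinal jM).
  rewrite -[X in size (Z X)]/(drop j (val (word phi n x))).
  rewrite val_word (drop_prefix_word T A hA phi hphi).
  rewrite truncn_ge_nat //; apply: le_trans (Fjx (n - j)%N _) _; first by lia.
  by rewrite ler_wpM2l // ler_nat leq_subr.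
pose p w := fine (mu (cylinder A T (w : n.-tuple 'I_r))).
set q := \sum_(w | Q w) p w; set q' := \sum_(w | ~~ Q w) p w.
have q0 : 0 <= q by apply: sumr_ge0 => w _; exact: cyl_ge0.
have q'0 : 0 <= q' by apply: sumr_ge0 => w _; exact: cyl_ge0.
have qq' : q + q' = 1.
  rewrite -(bigID Q predT) /= (sum_cylinder mu T mT A hA phi hphi n predT).
  by rewrite (_ : [set x | _] = [set: X]) ?probability_setT //; apply/seteqP.
have mQ := measurable_word T mT A hA phi hphi n Q.
have q_delta : 1 - delta < q.
  apply: lt_le_trans Udelta _.
  rewrite /q (sum_cylinder mu T mT A hA phi hphi n Q).
  by apply: fine_le; rewrite ?fin_num_measure //; apply: le_measure; rewrite ?inE.
have joinE : join_entropy mu T A n =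
    \sum_(w | Q w) eta (p w) + \sum_(w | ~~ Q w) eta (p w).
  by rewrite /join_entropy (bigID Q).
have MLn : (M.+1 <= n)%N by exact: leq_trans (leq_addl _ _) NMn.
have cardQ : (#|Q| <= M.+1 * r ^ M.+1 * 2 ^ m.+1)%N.
  by have := card_short_words _ Z n M.+1 m Zinj MLn; rewrite card_ord mulnA.
have groupQ : \sum_(w | Q w) eta (p w) <=
    (ln 2)^-1 + (log2 (M.+1 * r ^ M.+1)%:R + m.+1%:R).
  apply: le_trans (entropy_group _ Q p (cyl_ge0 n)) _.
  apply: lerD; first exact: eta_le.
  apply: (@le_trans _ _ (log2 #|Q|%:R)).
    by rewrite ler_piMl ?log2_natr_ge0 //; rewrite -qq' lerDl.
  apply: le_trans (ler_log2_natr _ _ cardQ) _.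
  rewrite natrM log2M ?ltr0n ?muln_gt0 ?expn_gt0 ?r0 //.
  by rewrite natrX log2X // log22 mulr1.
(* The exceptional words are counted trivially, by [r ^ n], but carry mass below [delta]. *)
have groupQ' : \sum_(w | ~~ Q w) eta (p w) <= (ln 2)^-1 + delta * (n%:R * lr).
  apply: le_trans (entropy_group _ (predC Q) p (cyl_ge0 n)) _.
  apply: lerD; first exact: eta_le.
  apply: ler_pM => //; first exact: log2_natr_ge0.
    by rewrite -/q'; move: q_delta qq'; lra.
  rewrite /lr -log2X ?ltr0n // -natrX; apply: ler_log2_natr.
  by apply: leq_trans (max_card _) _; rewrite card_tuple card_ord.
rewrite ler_pdivrMr // joinE; apply: le_trans (lerD groupQ groupQ') _.
have : delta * lr * n%:R <= e / 2 * n%:R by rewrite ler_pM2r.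
move: mcn Cn; rewrite /C -[m.+1%:R]natr1.
move: (ln (2 : R))^-1 (log2 _) (m%:R) (n%:R) => l2 lM m' n'.
lra.
Unshelve. all: by end_near. Qed.

Lemma compressed_of_lt Z c x : (K_Z R Z (phi x) < c%:E)%E ->
  exists N, compressed Z c N x.
Proof.
(* Taking [N.+1] forces [n] to be positive, so that the quotient can be cleared. *)
move=> /limn_esup_lt [N _ HN]; exists N.+1 => n Nn.
have := HN n (ltnW Nn); rewrite /= lee_fin ler_pdivrMr //.
by rewrite ltr0n (leq_trans _ Nn).
Qed.

Lemma K_Z_ae_eq (Z : seq 'I_r -> seq bool) : injective Z -> optimal_coding R Z ->
  {ae mu, forall x, K_Z R Z (phi x) = (ks_entropy mu T A)%:E}.
Proof.
move=> Zinj Zopt.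
pose a n := join_entropy mu T A n / n%:R.
have a0 n : 0 <= a n by rewrite divr_ge0 // join_entropy_ge0.
(* The index starts at 1: [a 0] is 0 by the convention for division by zero and would spoil the
   infimum. *)
pose E := [set a n.+1 | n in [set: nat]].
have infE : has_inf E by split; [exists (a 1), 0|exists 0 => _ [n _ <-]].
set h := inf E.
have ha n : (0 < n)%N -> h <= a n.
  by case: n => // n _; apply: ge_inf; [exact: infE.2|exists n].
have K_le_h : {ae mu, forall x, (K_Z R Z (phi x) <= h%:E)%E}.
  have /ae_foralln : forall n, {ae mu, forall x, (K_Z R Z (phi x) <= (a n.+1)%:E)%E}.
    by move=> n; exact: K_Z_le.
  apply: filterS => x Kx; apply/lee_addgt0Pr => e e0.
  have [_ [n _ <-] /ltW an] := inf_adherent e0 infE.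
  by apply: le_trans (Kx n) _; rewrite -EFinD lee_fin.
(* If all these sets were null, [K_Z] would be at least [c] almost everywhere, contradicting the
   upper bound by [h]. *)
have pos_compressed c : h < c -> exists N, (0 < mu (compressed Z c N))%E.
  move=> hc; apply: contrapT => noN.
  have F0 N : mu (compressed Z c N) = 0%E.
    apply/eqP; rewrite eq_le measure_ge0 andbT leNgt; apply/negP => F0.
    by apply: noN; exists N.
  have aeF : {ae mu, forall x, forall N, ~ compressed Z c N x}.
    apply: ae_foralln => N; exists (compressed Z c N).
    by split=> [||x /= /contrapT//]; [exact: measurable_compressed|exact: F0].
  have mu1 : (0 < mu [set: X])%E by rewrite probability_setT.
  have [x [nFx Kx]] := filter_ex (F := almost_everywhere mu)
    (FF := ae_properfilter_algebraOfSetsType mu1) (filterI aeF K_le_h).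
  have [|N] := compressed_of_lt Z c x; last exact: nFx.
  by apply: le_lt_trans Kx _; rewrite lte_fin.
(* Below, [h] is an infimum; above, the counting bound is used at rate [h + e / 2] with slack
   [e / 2]. *)
have a_h : a n @[n --> \oo] --> h.
  apply/cvgrPdist_le => e e0; near=> n.
  rewrite ler_distlC; apply/andP; split.
    by rewrite lerBlDr (le_trans (ha n _)) ?lerDl ?(ltW e0) //; near: n; exact: nbhs_infty_gt.
  rewrite [e in leRHS]splitr addrA; near: n.
  have [|N FN] := pos_compressed (h + e / 2); first by rewrite ltrDl divr_gt0.
  by apply: compressed_join_entropy FN _ => //; exact: divr_gt0.
have -> : ks_entropy mu T A = h by exact: cvg_lim a_h.
(* Positive measure at rate [h - m.+1%:R^-1], with slack half of that gap, would push some [a n.+1]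
   below the infimum [h]. *)
have K_ge : {ae mu, forall x, forall m N : nat, ~ compressed Z (h - m.+1%:R^-1) N x}.
  apply: ae_foralln => m; apply: ae_foralln => N.
  exists (compressed Z (h - m.+1%:R^-1) N).
  split=> [||x /= /contrapT//]; first exact: measurable_compressed.
  apply/eqP; rewrite eq_le measure_ge0 andbT leNgt; apply/negP => F0.
  have m2 : 0 < m.+1%:R^-1 / 2 :> R by rewrite divr_gt0 // invr_gt0.
  have [n _ /(_ n.+1 (leqnSn n))] := compressed_join_entropy Z _ N _ Zinj F0 m2.
  move: (ha n.+1 isT) m2; rewrite -/(a n.+1).
  by move: (a n.+1) (m.+1%:R^-1) => y q; lra.
apply: filterS2 K_le_h K_ge => x Kh nF; apply/eqP; rewrite eq_le Kh /=.
apply/lee_addgt0Pr => e e0.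
have [m me] : exists m : nat, m.+1%:R^-1 <= e.
  exists (Num.truncn e^-1); rewrite -[leRHS]invrK lef_pV2 ?posrE ?invr_gt0 //.
  by apply: ltW; exact: truncnS_gt.
rewrite -leeBlDr // leNgt; apply/negP => Ke.
have [|N] := compressed_of_lt Z (h - m.+1%:R^-1) x; last exact: nF.
by apply: lt_le_trans Ke _; rewrite -EFinB lee_fin lerB.
Unshelve. all: by end_near. Qed.

End Coding.

(** * Continuous maps and Borel probability measures *)

Lemma continuous_borel_measurable {R : realType} (X : pseudoPMetricType R) (T : X -> X) :
  continuous T -> measurable_fun [set: borel X] (T : borel X -> borel X).
Proof.
(* The open sets generate the Borel sigma-algebra, so only their preimages have to be checked. *)
move=> cT; apply: (@measurability _ _ (borel X) (borel X) setT T (@open X)) => // _ [B oB <-].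
by rewrite setTI; apply: sub_sigma_algebra; move/continuousP: cT; exact.
Qed.

Theorem theorem4p2 (R : realType) (X : pseudoPMetricType R)
  (hX : hausdorff_space X) (cX : compact [set: X])
  (T : X -> X) (cT : continuous T)
  (mu : probability (borel X) R)
  (inv : measure_invariant mu T) (erg : measure_ergodic mu T)
  (r : nat) (A : 'I_r -> set (borel X)) (hA : measurable_partition A)
  (phi : X -> nat -> 'I_r) (hphi : is_symbolic_coding A T phi)
  (Z : seq 'I_r -> seq bool) (Zinj : injective Z) (Zopt : optimal_coding R Z) :
  {ae mu, forall x : borel X, K_Z R Z (phi x) = (ks_entropy mu T A)%:E}.
Proof.
exact: (K_Z_ae_eq mu T (continuous_borel_measurable X T cT) inv erg A hA phi hphi Z).
Qed.
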